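(* Let $K$ be a field, let $\lambda\in K$, and let $A=\lambda I+B\in M_n(K)$ be a Jordan block. For the Yang-Baxter equation $AXA=XAX$ in the unknown $X\in M_n(K)$, the following are true. (1) If $\lambda\neq 0$ and $X\in M_n(K)$ satisfies $AXA=XAX$ and $\det(X)\neq 0$, then $X$ is similar to $A$. (2) If $\lambda\neq 0$ and $X\in M_n(K)$ satisfies $AXA=XAX$ and $\det(X)=0$, then $X=0$. (3) If $\lambda=0$, then the equation $AXA=XAX$ does not have any invertible solution $X\in M_n(K)$.
   Context: $M_n(K)$ is the set of $n\times n$ matrices over $K$ and $I$ is the identity matrix. $B\in M_n(K)$ denotes the nilpotent block with $1$ in the positions $(i,i+1)$ and $0$ elsewhere.
   Formalization: Part (3) is stated for n ≥ 2 only: for n = 1 and λ = 0 the block A is the zero matrix, so every X, including the invertible X = I, solves AXA = XAX, and the claim fails. *)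

(* Defs.v *)
From mathcomp Require Import all_boot all_order all_algebra.

Set Implicit Arguments.
Unset Strict Implicit.
Unset Printing Implicit Defensive.

Import GRing.Theory.
Local Open Scope ring_scope.

Definition nilpotent_block (K : fieldType) (n : nat) : 'M[K]_n :=
  \matrix_(i < n, j < n) (j == i.+1 :> nat)%:R.

Definition jordan_block (K : fieldType) (n : nat) (lambda : K) : 'M[K]_n :=
  lambda%:M + nilpotent_block K n.

Definition yang_baxter (K : fieldType) (n : nat) (A X : 'M[K]_n) : Prop :=
  A *m X *m A = X *m A *m X.

(* Main.v *)
Require Import Defs.
From mathcomp Require Import all_boot all_order all_algebra.

(** Rewriting the equation as [(AX)A = X(AX)] shows that [AX] conjugates [A]
    to [X] when both are invertible.  In general, with vectors written as
    rows, the kernel and the image of a solution [X] are stable under an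
    invertible [A]; every nonzero space stable under a Jordan block contains
    the last basis vector [u], so if [X] is singular and nonzero then
    [u = wX] and [uX = 0], and the equation forces [wAX = 0], hence [wX = 0],
    which is absurd.  If [lambda = 0], a solution [X] maps
    both [u] and the basis vector before it into the line [ker B] as soon as
    it is injective, a contradiction. *)

Set Implicit Arguments.
Unset Strict Implicit.
Unset Printing Implicit Defensive.

Import GRing.Theory.
Local Open Scope ring_scope.

Lemma yang_baxter_similar (K : fieldType) (n : nat) (A X : 'M[K]_n) :
  A \in unitmx -> X \in unitmx -> yang_baxter A X -> similar_in unitmx X A.
Proof.
move=> uA uX AXA; have uAX : A *m X \in unitmx by rewrite unitmx_mul uA.
exists (invmx (A *m X)); first by rewrite unitmx_inv.
apply/similarP; first by rewrite unitmx_inv.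
apply: (can_inj (mulmxK uAX)).
by rewrite mulmxKV // -mulmxA (mulmxA X) -AXA mulKmx.
Qed.

Lemma jordan_block_unit (K : fieldType) (n : nat) (lambda : K) :
  lambda != 0 -> jordan_block n lambda \in unitmx.
Proof.
(* The block is upper triangular and [det_trig] expects lower triangular, hence the transpose. *)
move=> l0; rewrite unitmxE unitfE -det_tr det_trig; last first.
  apply/is_trig_mxP => i j ltij; rewrite !mxE -val_eqE /= (gtn_eqF ltij).
  by rewrite (@ltn_eqF i j.+1) ?addr0 // ltnS ltnW.
apply/prodf_neq0 => i _.
by rewrite !mxE eqxx (@ltn_eqF i i.+1) // addr0.
Qed.

Lemma row_mul_nilpotent (K : fieldType) (n : nat) (v : 'rV[K]_n) (i j : 'I_n) :
  j = i.+1 :> nat -> (v *m nilpotent_block K n) 0 j = v 0 i.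
Proof.
move=> ji; rewrite mxE (bigD1 i) //= mxE ji eqxx mulr1 big1 ?addr0 // => k ki.
by rewrite mxE ji eqSS eq_sym val_eqE (negPf ki) mulr0.
Qed.

Lemma row_mul_nilpotent0 (K : fieldType) (n : nat) (v : 'rV[K]_n) (j : 'I_n) :
  j = 0%N :> nat -> (v *m nilpotent_block K n) 0 j = 0.
Proof. by move=> j0; rewrite mxE big1 // => k _; rewrite mxE j0 mulr0. Qed.

Lemma delta_mul_nilpotent_last (K : fieldType) (n : nat) :
  delta_mx 0 ord_max *m nilpotent_block K n.+1 = 0 :> 'rV_n.+1.
Proof.
by rewrite -rowE; apply/rowP => j; rewrite !mxE /= (ltn_eqF (ltn_ord j)).
Qed.

(** The block shifts coordinates one place to the right, so only the last one is lost. *)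
Lemma nilpotent_ker (K : fieldType) (n : nat) (v : 'rV[K]_n.+1) :
  v *m nilpotent_block K n.+1 = 0 -> v = v 0 ord_max *: delta_mx 0 ord_max.
Proof.
move=> vB; apply/rowP => j; rewrite !mxE eqxx /=.
case: eqVneq => [->|jm]; first by rewrite mulr1.
have lt : (j.+1 < n.+1)%N by rewrite ltn_neqAle eqSS jm ltn_ord.
by rewrite mulr0 -(@row_mul_nilpotent _ _ v j (Ordinal lt)) // vB mxE.
Qed.

Lemma nilpotent_stable_last (K : fieldType) (n m : nat) (V : 'M[K]_(m, n.+1)) :
  V != 0 -> stablemx V (nilpotent_block K n.+1) ->
  (delta_mx (0 : 'I_1) (ord_max : 'I_n.+1) <= V)%MS.
Proof.
move=> V0 sV; have [i vi0] : exists i, row i V != 0.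
  by apply/existsP; rewrite -negb_forall; apply: contra V0 => /forallP V0;
     apply/eqP/row_matrixP => i; rewrite row0; apply/eqP.
(* Only the last [k] coordinates of [v] may be nonzero. Each shift lowers [k], and the last nonzero
   iterate lies in the kernel line. *)
suff H k (v : 'rV[K]_n.+1) : (v <= V)%MS -> v != 0 ->
    (forall i : 'I_n.+1, (i + k < n.+1)%N -> v 0 i = 0) ->
    (delta_mx (0 : 'I_1) (ord_max : 'I_n.+1) <= V)%MS.
  apply: (H n.+1 _ (row_sub i V) vi0) => j.
  by rewrite ltnNge leq_addl.
elim: k v => [|k IH] v vV v0 vz.
  by case/eqP: v0; apply/rowP => j; rewrite mxE vz // addn0.
have [vB|vB] := eqVneq (v *m nilpotent_block K n.+1) 0.
  move: vV v0; rewrite (nilpotent_ker vB) scaler_eq0 => vV /norP[c0 _].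
  by rewrite -(eqmx_scale _ c0).
apply: (IH _ _ vB) => [|j jk].
  exact: submx_trans (submxMr _ vV) sV.
case: j jk => -[|j] jlt /= jk; first exact: row_mul_nilpotent0.
by rewrite (@row_mul_nilpotent _ _ v (Ordinal (ltnW jlt))) // vz // addnS.
Qed.

(** Subtracting a scalar matrix preserves stability of a subspace. *)
Lemma jordan_stable_last (K : fieldType) (n m : nat) (lambda : K)
    (V : 'M[K]_(m, n.+1)) :
  V != 0 -> stablemx V (jordan_block n.+1 lambda) ->
  (delta_mx (0 : 'I_1) (ord_max : 'I_n.+1) <= V)%MS.
Proof.
move=> V0 sV; apply: nilpotent_stable_last => //.
have -> : nilpotent_block K n.+1 = jordan_block n.+1 lambda - lambda%:M.
  by rewrite addrC addKr.
by rewrite mulmxBr addmx_sub // eqmx_opp mul_mx_scalar scalemx_sub.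
Qed.

Lemma yang_baxter_kermx (K : fieldType) (n : nat) (A X : 'M[K]_n) :
  A \in unitmx -> yang_baxter A X -> stablemx (kermx X) A.
Proof.
move=> uA AXA; apply/sub_kermxP; apply: (can_inj (mulmxK uA)).
by rewrite mul0mx -!mulmxA (mulmxA A) AXA !mulmxA mulmx_ker !mul0mx.
Qed.

(** The equation gives $XA = A^{-1}(AXA) = A^{-1}XAX$, whose rows are combinations of rows of
    $X$. *)
Lemma yang_baxter_image (K : fieldType) (n : nat) (A X : 'M[K]_n) :
  A \in unitmx -> yang_baxter A X -> stablemx X A.
Proof.
move=> uA AXA; rewrite -[X in (X *m A <= _)%MS](mulKmx uA) -mulmxA.
by rewrite mulmx_sub // AXA submxMl.
Qed.

Lemma yang_baxter_jordan_singular (K : fieldType) (n : nat) (lambda : K)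
    (X : 'M[K]_n) :
  lambda != 0 -> yang_baxter (jordan_block n lambda) X ->
  \det X = 0 -> X = 0.
Proof.
case: n X => [|n] X l0; first by rewrite det_mx00 => _ /eqP; rewrite oner_eq0.
have uA := jordan_block_unit n.+1 l0; set A := jordan_block _ _ in uA *.
move=> AXA X0; apply/eqP/negPn/negP => Xn0.
set u : 'rV[K]_n.+1 := delta_mx 0 ord_max.
have K0 : kermx X != 0.
  by rewrite kermx_eq0 row_free_unit unitmxE X0 unitr0.
have sK := yang_baxter_kermx uA AXA.
have uX : u *m X = 0 by apply/sub_kermxP; apply: jordan_stable_last K0 sK.
have /submxP[w uw] : (u <= X)%MS.
  exact: jordan_stable_last Xn0 (yang_baxter_image uA AXA).
have uAE : u *m A = lambda *: u.
  by rewrite mulmxDr mul_mx_scalar delta_mul_nilpotent_last addr0.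
(* Indeed $wAXA = wXAX = uAX = \lambda uX = 0$. *)
have wAX : w *m A *m X = 0.
  apply: (can_inj (mulmxK uA)).
  by rewrite mul0mx -!mulmxA (mulmxA A) AXA !mulmxA -uw uAE -scalemxAl uX scaler0.
(* As $A$ preserves rank, stability of the kernel is an equality, so $A$ can be cancelled from $wA
   \in \ker X$. *)
have KA : (kermx X <= kermx X *m A)%MS.
  by rewrite -(geq_leqif (mxrank_leqif_sup sK)) mxrankMfree // row_free_unit.
have /submxP[y wy] : (w *m A <= kermx X *m A)%MS.
  by apply: submx_trans KA; apply/sub_kermxP.
have wK : w = y *m kermx X by apply: (can_inj (mulmxK uA)); rewrite wy mulmxA.
have /rowP/(_ ord_max)/eqP : u = 0 by rewrite uw wK -mulmxA mulmx_ker mulmx0.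
by rewrite !mxE !eqxx oner_eq0.
Qed.

Lemma yang_baxter_nilpotent_not_unit (K : fieldType) (n : nat)
    (X : 'M[K]_n.+2) :
  yang_baxter (nilpotent_block K n.+2) X -> X \notin unitmx.
Proof.
set B := nilpotent_block _ _ => BXB; apply/negP => uX.
set u : 'rV[K]_n.+2 := delta_mx 0 ord_max.
have uB : u *m B = 0 by apply: delta_mul_nilpotent_last.
have lt : (n < n.+2)%N by [].
pose w : 'rV[K]_n.+2 := delta_mx 0 (Ordinal lt).
have wB : w *m B = u.
  by rewrite -rowE; apply/rowP => j; rewrite !mxE eqxx.
(* By the equation $(vXB)X = vBXB = 0$, so $vX$ lies in the kernel of $B$, the line of $u$. *)
have kerX v : v *m B *m X *m B = 0 -> exists c, v *m X = c *: u.
  move=> vBXB; exists ((v *m X) 0 ord_max); apply: nilpotent_ker.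
  apply: (can_inj (mulmxK uX)).
  by rewrite mul0mx -!mulmxA (mulmxA X) -BXB !mulmxA.
have [c uXc] : exists c, u *m X = c *: u by apply: kerX; rewrite uB !mul0mx.
have [d wXd] : exists d, w *m X = d *: u.
  by apply: kerX; rewrite wB uXc -scalemxAl uB scaler0.
(* Both sides have image $cd\,u$ under the injective $X$; multiplying by $B$ then gives $cu = 0$. *)
have cw : c *: w = d *: u.
  apply: (can_inj (mulmxK uX)).
  by rewrite -!scalemxAl wXd uXc !scalerA mulrC.
have cu : c *: u = 0.
  by rewrite -wB scalemxAl cw -scalemxAl uB scaler0.
have /rowP/(_ ord_max)/eqP : u = 0.
  by apply: (can_inj (mulmxK uX)); rewrite uXc cu mul0mx.
by rewrite !mxE !eqxx oner_eq0.
Qed.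

(* The bound 1 < n is needed only in the third part: the 1 x 1 block with
   eigenvalue 0 is the zero matrix, and then every X is a solution. *)
Theorem theorem2p1 (K : fieldType) (n : nat) (lambda : K) :
  [/\ forall X : 'M[K]_n,
        lambda != 0 -> yang_baxter (jordan_block n lambda) X ->
        \det X != 0 -> similar_in unitmx X (jordan_block n lambda),
      forall X : 'M[K]_n,
        lambda != 0 -> yang_baxter (jordan_block n lambda) X ->
        \det X = 0 -> X = 0
    & (1 < n)%N -> lambda = 0 ->
        ~ exists2 X : 'M[K]_n,
            X \in unitmx & yang_baxter (jordan_block n lambda) X].
Proof.
split=> [X l0 AXA X0|X|].
- apply: yang_baxter_similar AXA; first exact: jordan_block_unit.
  by rewrite unitmxE unitfE.
- exact: yang_baxter_jordan_singular.
case: n => [|[|n]] // _ -> [X uX].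
rewrite /jordan_block raddf0 add0r => /yang_baxter_nilpotent_not_unit.
by rewrite uX.
Qed.
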